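(* Let $(a_n)_{n\ge0}$ be a sequence of complex numbers and let $f(z)=\sum_{n=0}^\infty a_n z^n$. Suppose that $f(1)$, $f(-1)$ and $f'(1)$ exist, in the sense that the series $f(1)=\sum_{n=0}^\infty a_n$, $f(-1)=\sum_{n=0}^\infty(-1)^n a_n$ and $f'(1)=\sum_{n=1}^\infty n a_n$ converge. Then $$\sum_{k=1}^\infty\left\lfloor\frac{k}{2}\right\rfloor a_k=\frac12\left(f'(1)-\sum_{n=0}^\infty a_{2n+1}\right).$$
   Context: $\lfloor x\rfloor$ denotes the floor function. Infinite series are understood as limits of partial sums. *)

(* Defs.v *)
From Stdlib Require Import Reals.
From Coquelicot Require Import Coquelicot.

(* The normed-module structure on C is pinned explicitly because Coquelicot
   also has C over R; Series itself is only available for real sequences. *)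
Definition is_Cseries (a : nat -> C) (l : C) : Prop :=
  @is_series C_AbsRing C_NormedModule a l.

Definition ex_Cseries (a : nat -> C) : Prop := exists l : C, is_Cseries a l.

(* Main.v *)
Require Import Defs.
From Stdlib Require Import Reals Lra Lia.
From Coquelicot Require Import Coquelicot.
Open Scope C_scope.

(** The sequence b_n = (a_n - (-1)^n a_n) / 2 keeps the odd-indexed terms of a
    and replaces the others by 0 ([odd_part_even], [odd_part_odd]).  As a linear
    combination of the series at 1 and -1 its series converges, and the
    sum of a_(2n+1) is obtained from it by deleting the zero terms
    ([is_Cseries_odd_terms]).  Because
    floor (n / 2) = (n - (1 - (-1)^n) / 2) / 2, the term floor (n / 2) a_n is
    half of n a_n - b_n ([Int_part_half]); since b_0 = 0, both series may be
    started at n = 1, and subtracting them gives the formula. *)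

Definition odd_part (a : nat -> C) (n : nat) : C :=
  / 2 * (a n - RtoC ((-1) ^ n) * a n).

Lemma odd_part_even (a : nat -> C) (m : nat) : odd_part a (2 * m) = 0.
Proof.
  unfold odd_part. rewrite pow_1_even. ring.
Qed.

Lemma odd_part_odd (a : nat -> C) (m : nat) :
  odd_part a (2 * m + 1) = a (2 * m + 1)%nat.
Proof.
  unfold odd_part.
  rewrite Nat.add_1_r, pow_1_odd.
  change (RtoC (-1)) with (RtoC (- (1))). rewrite RtoC_opp. field.
Qed.

Lemma Int_part_half (n : nat) :
  IZR (Int_part (INR n / 2)) = ((INR n - (1 - (-1) ^ n) / 2) / 2)%R.
Proof.
  destruct (Nat.Even_or_Odd n) as [[m ->] | [m ->]].
  - rewrite <- (Int_part_spec _ (Z.of_nat m));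
      rewrite <- INR_IZR_INZ, mult_INR; simpl (INR 2); [| lra].
    rewrite pow_1_even. field.
  - rewrite <- (Int_part_spec _ (Z.of_nat m));
      rewrite <- INR_IZR_INZ, plus_INR, mult_INR; simpl (INR 2); simpl (INR 1);
      [| lra].
    rewrite Nat.add_1_r, pow_1_odd. field.
Qed.

Lemma is_Cseries_minus (u v : nat -> C) (lu lv : C) :
  is_Cseries u lu -> is_Cseries v lv ->
  is_Cseries (fun n => u n - v n) (lu - lv).
Proof.
  exact (@is_series_minus C_AbsRing C_NormedModule u v lu lv).
Qed.

Lemma is_Cseries_scal (c : C) (u : nat -> C) (l : C) :
  is_Cseries u l -> is_Cseries (fun n => c * u n) (c * l).
Proof.
  exact (@is_series_scal C_AbsRing C_NormedModule c u l).
Qed.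

Lemma is_Cseries_ext (u v : nat -> C) (l : C) :
  (forall n, u n = v n) -> is_Cseries u l -> is_Cseries v l.
Proof.
  exact (@is_series_ext C_AbsRing C_NormedModule u v l).
Qed.

(** As the other terms vanish, the partial sums of the odd-indexed terms are the
    partial sums of [b] up to the indices 2n+1, hence a subsequence of a
    convergent sequence. *)
Lemma is_Cseries_odd_terms (b : nat -> C) (l : C) :
  (forall m, b (2 * m)%nat = 0) -> is_Cseries b l ->
  is_Cseries (fun n => b (2 * n + 1)%nat) l.
Proof.
  intros b_even cv_b.
  assert (sum_odd : forall n, @sum_n C_NormedModule b (2 * n + 1)
    = @sum_n C_NormedModule (fun m => b (2 * m + 1)%nat) n).
  { induction n as [| n IH].
    - change (2 * 0 + 1)%nat with 1%nat.
      rewrite sum_Sn, !sum_O, (b_even 0%nat : b 0%nat = 0). apply (plus_zero_l (b 1%nat)).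
    - replace (2 * S n + 1)%nat with (S (S (2 * n + 1))) by lia.
      rewrite !sum_Sn, IH.
      replace (S (2 * n + 1)) with (2 * S n)%nat by lia.
      rewrite b_even.
      replace (S (2 * S n)) with (2 * S n + 1)%nat by lia.
      f_equal. apply (plus_zero_r (_ : C_NormedModule)). }
  unfold is_Cseries, is_series.
  apply (filterlim_ext _ _ sum_odd).
  apply (filterlim_comp _ _ _ (fun n => (2 * n + 1)%nat)
           (@sum_n C_NormedModule b) _ eventually); [| exact cv_b].
  apply eventually_subseq. intros n. lia.
Qed.

Theorem corollary2 (a : nat -> C) (f'1 : C)
  (cv_f1 : ex_Cseries (fun n : nat => a n))
  (cv_fm1 : ex_Cseries (fun n : nat => RtoC ((-1) ^ n) * a n))
  (cv_f'1 : is_Cseries (fun n : nat => RtoC (INR (S n)) * a (S n)) f'1) :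
  exists s_odd : C,
    is_Cseries (fun n : nat => a (2 * n + 1)%nat) s_odd /\
    is_Cseries (fun k : nat => RtoC (IZR (Int_part (INR (S k) / 2))) * a (S k))
      (/ 2 * (f'1 - s_odd)).
Proof.
  destruct cv_f1 as [l1 cv1], cv_fm1 as [lm1 cvm1].
  assert (cv_b : is_Cseries (odd_part a) (/ 2 * (l1 - lm1))).
  { apply is_Cseries_scal, is_Cseries_minus; assumption. }
  exists (/ 2 * (l1 - lm1)). split.
  - apply (is_Cseries_ext _ _ _ (odd_part_odd a)).
    apply is_Cseries_odd_terms; [apply odd_part_even | exact cv_b].
  - assert (cv_b1 : is_Cseries (fun k => odd_part a (S k)) (/ 2 * (l1 - lm1))).
    { apply (@is_series_incr_1 C_AbsRing C_NormedModule).
      rewrite (odd_part_even a 0 : odd_part a O = 0).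
      rewrite (plus_zero_r (_ : C_NormedModule)). exact cv_b. }
    refine (is_Cseries_ext _ _ _ _
              (is_Cseries_scal (/ 2) _ _ (is_Cseries_minus _ _ _ _ cv_f'1 cv_b1))).
    intros k. cbv beta. rewrite Int_part_half. unfold odd_part.
    rewrite !RtoC_div, !RtoC_minus, RtoC_div, RtoC_minus by lra. field.
Qed.
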